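(* Let $a$ and $b$ be two vertices in different partite sets of a complete bipartite graph $K_{n,n}$ with $n>2$. Then the complementary prism $K_{n,n}\overline{K_{n,n}}$ exhibits perfect state transfer with respect to the Laplacian matrix between $\frac{1}{\sqrt{2}}(\mathbf{e}_a+\mathbf{e}_b)$ and $\frac{1}{\sqrt{2}}(\mathbf{e}_{a'}+\mathbf{e}_{b'})$ if and only if $n$ is a multiple of $4$. If $n=2$ and $K_{2,2}$ has partite sets $\{1,2\}$ and $\{3,4\}$, then $K_{2,2}\overline{K_{2,2}}$ exhibits perfect state transfer with respect to the Laplacian matrix between $\frac{1}{\sqrt{2}}(\mathbf{e}_1+\mathbf{e}_3)$ and $\frac{1}{\sqrt{2}}(\mathbf{e}_{2'}+\mathbf{e}_{4'})$.
   Context: The complementary prism $G\overline{G}$ of a graph $G$ is obtained from the disjoint union of $G$ and its complement $\overline{G}$ (vertices relabelled $a'$ for $a\in V(G)$) by adding an edge between each vertex $a$ of $G$ and its copy $a'$ in $\overline{G}$. The Laplacian matrix is $L=D-A$, with $A$ the adjacency matrix and $D$ the diagonal degree matrix. For a real symmetric matrix $M$ associated with a graph, $U_M(t)=\exp(itM)$. There is perfect state transfer between two linearly independent real unit vectors $\mathbf{u},\mathbf{v}$ with respect to $M$ if there exist $\tau>0$ and $\gamma\in\mathbb{C}$ with $|\gamma|=1$ such that $U_M(\tau)\mathbf{u}=\gamma\mathbf{v}$. $\mathbf{e}_x$ is the characteristic vector of the vertex $x$ of the complementary prism. *)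

(* Defs.v *)
(* Uses MathComp-Analysis; R[i] is the field of complex
   numbers over a realType R (mathcomp-real-closed). *)
From HB Require Import structures.
From mathcomp Require Import all_boot all_order all_algebra.
From mathcomp Require Import all_classical all_reals all_analysis.
From mathcomp Require Import complex.

Set Implicit Arguments.
Unset Strict Implicit.
Unset Printing Implicit Defensive.

Import Order.TTheory GRing.Theory Num.Theory.
Import numFieldNormedType.Exports.

Local Open Scope ring_scope.

Record sgraph (V : finType) := SGraph {
  adj :> rel V;
  adj_sym : symmetric adj;
  adj_irr : irreflexive adj }.

Section Graphs.
Variables (V : finType) (G : sgraph V).

Definition compl_adj : rel V := [rel x y | (x != y) && ~~ G x y].

Lemma compl_adj_sym : symmetric compl_adj.
Proof. by move=> x y; rewrite /compl_adj /= (eq_sym x) (adj_sym G x). Qed.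

Lemma compl_adj_irr : irreflexive compl_adj.
Proof. by move=> x; rewrite /compl_adj /= eqxx. Qed.

Definition complement : sgraph V := SGraph compl_adj_sym compl_adj_irr.

(* In the complementary prism, [inl x] is the vertex x of G and [inr x] is its
   copy x' in the complement of G. *)
Definition prism_adj : rel (V + V) := fun p q =>
  match p, q with
  | inl x, inl y => G x y
  | inr x, inr y => complement x y
  | inl x, inr y | inr x, inl y => x == y
  end.

Lemma prism_adj_sym : symmetric prism_adj.
Proof.
move=> [x|x] [y|y]; [exact: adj_sym|exact: eq_sym|exact: eq_sym|].
exact: compl_adj_sym.
Qed.

Lemma prism_adj_irr : irreflexive prism_adj.
Proof. by move=> [x|x]; [exact: adj_irr|exact: compl_adj_irr]. Qed.

Definition complementary_prism : sgraph (V + V)%type :=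
  SGraph prism_adj_sym prism_adj_irr.

(* G is the complete bipartite graph with partite sets X and Y. *)
Definition complete_bipartite (X Y : {set V}) : Prop :=
  Y = (~: X)%SET /\
  forall x y, G x y = (x \in X) && (y \in Y) || (x \in Y) && (y \in X).

(* Rows and columns are indexed by the vertices through [enum_val]. *)
Definition adjacency_mx (R : pzRingType) : 'M[R]_#|V| :=
  \matrix_(i, j) (G (enum_val i) (enum_val j))%:R.

Definition degree (x : V) : nat := #|[set y | G x y]|.

Definition degree_mx (R : pzRingType) : 'M[R]_#|V| :=
  diag_mx (\row_i (degree (enum_val i))%:R).

Definition laplacian (R : pzRingType) : 'M[R]_#|V| :=
  degree_mx R - adjacency_mx R.

End Graphs.

Arguments adjacency_mx {V} G R.
Arguments degree_mx {V} G R.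
Arguments laplacian {V} G R.

Definition vertex_vec (R : pzRingType) (V : finType) (x : V) : 'cV[R]_#|V| :=
  delta_mx (enum_rank x) 0.

Arguments vertex_vec R {V} x.

(* The limit is taken in the topology of matrices, i.e., entrywise. *)
Definition expmx (K : numFieldType) (n : nat) (A : 'M[K]_n) : 'M[K]_n :=
  limn (series (fun k => k`!%:R^-1 *: A ^+ k)).

Section StateTransfer.
Variables (R : realType) (n : nat).

Definition complexify (m p : nat) (A : 'M[R]_(m, p)) : 'M[R[i]]_(m, p) :=
  map_mx (real_complex R) A.

Definition transition_mx (M : 'M[R]_n) (t : R) : 'M[R[i]]_n :=
  expmx (('i * t%:C%C) *: complexify M).

(* Euclidean norm: the norm [`|u|] of the library is the sup norm. *)
Definition unit_vec (u : 'cV[R]_n) : Prop :=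
  Num.sqrt (\sum_i u i 0 ^+ 2) = 1.

Definition perfect_state_transfer (M : 'M[R]_n) (u v : 'cV[R]_n) : Prop :=
  [/\ unit_vec u, unit_vec v, free [:: u; v] &
      exists (tau : R) (gamma : R[i]),
        [/\ 0 < tau, `|gamma| = 1 &
            transition_mx M tau *m complexify u = gamma *: complexify v]].

End StateTransfer.

(* (e_x + e_y) / sqrt 2 *)
Definition plus_state (R : realType) (V : finType) (x y : V) : 'cV[R]_#|V| :=
  (Num.sqrt 2)^-1 *: (vertex_vec R x + vertex_vec R y).

Arguments plus_state R {V} x y.

(* Main.v *)
Require Import Defs.
From mathcomp Require Import all_boot all_order all_algebra.
From mathcomp Require Import all_classical all_reals all_analysis.
From mathcomp Require Import complex.
From mathcomp Require Import ring.

(** Write the state at a and b as the constant 1/n on both partite sets plus the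
deviation [dev a b] of the indicator of {a, b} from its mean 1/n.  On each
partite set the deviation sums to zero.  A function that is an eigenvector of
the Laplacians of G and of its complement for the same eigenvalue [lam] spans,
together with its copy in the complement, a plane that is invariant under the
Laplacian of the prism: there it acts as [lam] plus the Laplacian of a single
edge, with eigenvalues [lam] and [lam + 2].  So exp(itL) multiplies the plane by
exp(it lam) and transfers amplitude along the edge, with factors
(1 + exp(2it)) / 2 for staying and (1 - exp(2it)) / 2 for crossing
([transition_prism_eigen]).  Constants have [lam = 0] for both graphs; functions
that sum to zero on each part of K_{n,n} have [lam = n] for both.  With
z = exp(it) the state at time t is therefore
(1 +- z^2) / 2 * (1/n + z^n * dev), up to the factor 1 / sqrt 2, with + on G and
- on its copy ([transition_plus_state]).

Transfer to a' and b' forces the amplitude on G to vanish and, since n > 1, the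
amplitude at some x' with x different from a and b to vanish too.  These
equations say z^2 = -1 and z^n = 1, that is, 4 | n.  Conversely at t = pi / 2 we
have z = i, everything has crossed to the copy, and the amplitude there is
1/n + i^n * dev: the indicator of {a, b} if 4 | n, and that of the complement of
{a, b} if n = 2, because then i^n = -1 and 1 - ([x = a] + [x = b]) is left.

The matrix exponential is a limit of partial sums, so the series must be shown to
converge ([is_cvg_series_transition]).  For a real matrix M the entries of the
partial sums of exp(itM) split into real and imaginary parts whose terms are
those of cos t and sin t, weighted by entries of powers of M; these weights grow
at most geometrically.  Once convergence is known, exp(itM) acts on an
eigenvector by comparing limits of partial sums, with no diagonalization of
M. *)

Set Implicit Arguments.
Unset Strict Implicit.
Unset Printing Implicit Defensive.

Import Order.TTheory GRing.Theory Num.Theory.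
Import numFieldNormedType.Exports.

Local Open Scope classical_set_scope.
Local Open Scope ring_scope.

(** * Convergence in matrix spaces and eigenvectors of matrix exponentials *)

Lemma cvg_mx (T : topologicalType) (m n : nat) (F : nat -> 'M[T]_(m, n))
    (L : 'M[T]_(m, n)) :
  (forall i j, F k i j @[k --> \oo] --> L i j) -> F k @[k --> \oo] --> L.
Proof.
move=> FL U [P LP sPU].
have PF : \forall k \near \oo, forall i j, P i j (F k i j).
  by apply: filter_forall => i; apply: filter_forall => j; exact: (FL i j).
by rewrite /= /fmap /=; apply: filterS PF => k Pk; exact: sPU.
Qed.

Lemma mulmx_eigen_pow (K : comPzRingType) (n : nat) (A : 'M[K]_n) (v : 'cV[K]_n) lam k :
  A *m v = lam *: v -> (A ^+ k) *m v = lam ^+ k *: v.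
Proof.
move=> Av; elim: k => [|k IH]; first by rewrite !expr0 scale1r mul1mx.
by rewrite !exprSr -mulmxA Av -scalemxAr IH scalerA mulrC.
Qed.

(** The partial sums of the exponential of [A] map [v] to multiples of [v].
Convergence of the whole matrix series has to be assumed: otherwise [expmx A] is
an arbitrary matrix. *)
Lemma expmx_eigen (K : numFieldType) (n : nat) (A : 'M[K]_n) (v : 'cV[K]_n)
    (lam c : K) :
  cvgn (series (fun k => k`!%:R^-1 *: A ^+ k)) ->
  series (fun k => k`!%:R^-1 * lam ^+ k) @ \oo --> c ->
  A *m v = lam *: v -> expmx A *m v = c *: v.
Proof.
move=> cA cc Av; apply/colP => i; rewrite !mxE.
pose S := series (fun k => k`!%:R^-1 *: A ^+ k).
have E k : \sum_j S k i j * v j 0 = (series (fun k => k`!%:R^-1 * lam ^+ k) k) * v i 0.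
  have : S k *m v = (series (fun k => k`!%:R^-1 * lam ^+ k) k) *: v.
    rewrite /S /series /= mulmx_suml scaler_suml; apply: eq_bigr => l _.
    by rewrite -scalemxAl (mulmx_eigen_pow _ Av) scalerA.
  by move/colP/(_ i); rewrite !mxE.
apply: (@cvg_unique _ (@norm_hausdorff K K^o) (\sum_j S k i j * v j 0 @[k --> \oo])).
  apply: cvg_big => // [|j _]; first exact: add_continuous.
  apply: cvgM; last exact: cvg_cst.
  exact: (cvg_comp _ _ cA (@coord_continuous K n n i j _)).
rewrite (funext E).
by apply: cvgM => //; exact: cvg_cst.
Qed.

(** * The complex exponential on the imaginary axis *)

Lemma cvg_real_complex (R : realType) (u : nat -> R) (l : R) :
  u @ \oo --> l ->
  (u k)%:C%C @[k --> \oo] --> (l%:C%C : (R[i] : numFieldType)).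
Proof.
move=> /cvgrPdist_lt ul; apply/(@cvgrPdist_lt _ (R[i] : numFieldType)) => e.
rewrite ltcE => /andP[/eqP ie re].
apply: filterS (ul (complex.Re e) re) => k.
rewrite -raddfB normc_def /= expr0n addr0 sqrtr_sqr => h.
by rewrite ltcE /= ie eqxx.
Qed.

Lemma cvg_complex (R : realType) (a b : nat -> R) (x y : R) :
  a @ \oo --> x -> b @ \oo --> y ->
  (a k)%:C%C + 'i * (b k)%:C%C @[k --> \oo] -->
    (x%:C%C + 'i * y%:C%C : (R[i] : numFieldType)).
Proof.
move=> ax bx.
apply: (@cvgD (R[i] : numFieldType) (R[i] : numFieldType)^o).
  exact: cvg_real_complex.
apply: (@cvgM (R[i] : numFieldType)); first exact: cvg_cst.
exact: cvg_real_complex.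
Qed.

(** Even powers of i are real and odd ones imaginary: Euler's formula term by
term. *)
Lemma exp_coeff_imaginary (R : realType) (x : R) k :
  k`!%:R^-1 * ('i * x%:C%C) ^+ k =
  (cos_coeff x k)%:C%C + 'i * (sin_coeff x k)%:C%C :> R[i].
Proof.
have i2 m : 'i ^+ m.*2 = ((-1) ^+ m)%:C%C :> R[i].
  by rewrite -mul2n exprM sqrCi rmorphXn rmorphN1.
have fE : k`!%:R^-1 = (k`!%:R^-1)%:C%C :> R[i] by rewrite fmorphV rmorph_nat.
rewrite exprMn -rmorphXn fE /cos_coeff /sin_coeff /= !rmorphM !rmorph_nat.
rewrite -[in 'i ^+ k](odd_double_half k) exprD i2.
have [ok|ek] := boolP (odd k); rewrite /= !(expr0, expr1, mul0r, mul1r, mulr0, add0r, addr0).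
  have -> : k.-1./2 = k./2 by case: (k) ok => //= n; rewrite uphalf_half => /negPf ->.
  by ring.
by ring.
Qed.

Definition cis (R : realType) (t : R) : R[i] := (cos t)%:C%C + 'i * (sin t)%:C%C.

Lemma cvg_series_cis (R : realType) (x : R) :
  series (fun k => k`!%:R^-1 * ('i * x%:C%C) ^+ k) @ \oo -->
    (cis x : (R[i] : numFieldType)).
Proof.
under [X in series X]funext do rewrite exp_coeff_imaginary.
rewrite [X in X @ _](_ : _ = fun n =>
    (series (cos_coeff x) n)%:C%C + 'i * (series (sin_coeff x) n)%:C%C).
  rewrite /cis cos.unlock sin.unlock; apply: cvg_complex.
    exact: is_cvg_series_cos_coeff.
  exact: is_cvg_series_sin_coeff.
apply/funext => n; rewrite /series /= !rmorph_sum mulr_sumr -big_split /=.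
by apply: eq_bigr.
Qed.

Lemma cisD (R : realType) (x y : R) : cis (x + y) = cis x * cis y.
Proof.
rewrite /cis cosD sinD !(rmorphD, rmorphB, rmorphM) /=.
have i2 : 'i * 'i = -1 :> R[i] by rewrite -expr2 sqrCi.
rewrite mulrDl !mulrDr -!addrA; ring: i2.
Qed.

Lemma cis0 (R : realType) : cis 0 = 1 :> R[i].
Proof. by rewrite /cis cos0 sin0 mulr0 addr0. Qed.

Lemma cisMn (R : realType) (x : R) m : cis (x * m%:R) = cis x ^+ m.
Proof.
elim: m => [|m IH]; first by rewrite mulr0 cis0.
by rewrite -[m.+1]addn1 natrD mulrDr cisD IH mulr1 exprD.
Qed.

Lemma cis_pihalf (R : realType) : cis (pi / 2) = 'i :> R[i].
Proof. by rewrite /cis cos_pihalf sin_pihalf add0r mulr1. Qed.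

(** * The transition matrix of a real matrix *)

(** Geometric growth is what absolute convergence of the exponential series calls
for: the factorial dominates it for any base. *)
Lemma le_norm_mx_pow (R : realType) (n : nat) (M : 'M[R]_n) k i j :
  `|(M ^+ k) i j| <= (\sum_i \sum_j `|M i j|) ^+ k.
Proof.
set c := \sum_i _.
have c0 : 0 <= c by rewrite sumr_ge0 // => i' _; rewrite sumr_ge0.
elim: k j => [|k IH] j; first by rewrite !expr0 mxE; case: eqP; rewrite ?normr1 ?normr0.
rewrite !exprSr mxE (le_trans (ler_norm_sum _ _ _)) //.
apply: (@le_trans _ _ (\sum_l c ^+ k * `|M l j|)).
  by apply: ler_sum => l _; rewrite normrM ler_wpM2r.
rewrite -mulr_sumr ler_wpM2l ?exprn_ge0 //.
by apply: ler_sum => l _; rewrite (bigD1 j) //= lerDl sumr_ge0.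
Qed.

(** Comparison with the exponential series of [`|x| * c]. *)
Lemma cvg_series_bounded (R : realType) (a u : nat -> R) (x c : R) :
  (forall k, `|a k| <= exp_coeff `|x| k) -> (forall k, `|u k| <= c ^+ k) ->
  0 <= c ->
  cvgn (series (fun k => a k * u k)).
Proof.
move=> ax uc c0; apply: (@normed_cvg R R^o).
apply: (@series_le_cvg _ _ (exp_coeff (`|x| * c))).
- by move=> k /=; exact: normr_ge0.
- by move=> k; apply: exp_coeff_ge0; exact: mulr_ge0.
- move=> k /=; rewrite normrM /exp_coeff /= exprMn mulrAC.
  by apply: ler_pM => //; exact: ax.
- exact: is_cvg_series_exp_coeff.
Qed.

(** Since M is real, the powers of i are the only source of imaginary parts, so
every entry splits into two absolutely convergent real series. *)
Lemma is_cvg_series_transition (R : realType) (n : nat) (M : 'M[R]_n) (t : R) :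
  cvgn (series (fun k => k`!%:R^-1 *:
     (('i * t%:C%C) *: complexify M) ^+ k : 'M[(R[i] : numFieldType)]_n)).
Proof.
pose re i j k := cos_coeff t k * (M ^+ k) i j.
pose im i j k := sin_coeff t k * (M ^+ k) i j.
have cc k : `|cos_coeff t k| <= exp_coeff `|t| k.
  rewrite /cos_coeff /exp_coeff /= !normrM normfV normrX normrN1 expr1n mulr1.
  rewrite normrX !normr_nat ler_wpM2r ?invr_ge0 // ler_piMl ?exprn_ge0 //.
  by case: odd.
have cs k : `|sin_coeff t k| <= exp_coeff `|t| k.
  rewrite /sin_coeff /exp_coeff /= !normrM normfV normrX normrN1 expr1n mulr1.
  rewrite normrX !normr_nat ler_wpM2r ?invr_ge0 // ler_piMl ?exprn_ge0 //.
  by case: odd.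
have c0 : 0 <= \sum_i \sum_j `|M i j|.
  by rewrite sumr_ge0 // => i _; rewrite sumr_ge0.
have cre i j : cvgn (series (re i j)).
  by apply: (cvg_series_bounded cc) c0 => k; exact: le_norm_mx_pow.
have cim i j : cvgn (series (im i j)).
  by apply: (cvg_series_bounded cs) c0 => k; exact: le_norm_mx_pow.
have pE k : (('i * t%:C%C) *: complexify M) ^+ k = ('i * t%:C%C) ^+ k *: complexify (M ^+ k).
  elim: k => [|k IH]; first by rewrite !expr0 scale1r /complexify map_mx1.
  by rewrite !exprSr IH -[LHS]/(_ *m _) -scalemxAl -scalemxAr scalerA /complexify map_mxM.
pose L : 'M[(R[i] : numFieldType)]_n := \matrix_(i, j)
  ((limn (series (re i j)))%:C%C + 'i * (limn (series (im i j)))%:C%C).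
apply: (cvgP L).
apply: cvg_mx => i j; rewrite mxE.
rewrite [X in X @ _](_ : _ = fun n =>
    (series (re i j) n)%:C%C + 'i * (series (im i j) n)%:C%C).
  by apply: cvg_complex; [exact: cre|exact: cim].
apply/funext => m; rewrite /series /= !rmorph_sum mulr_sumr -big_split /= summxE.
apply: eq_bigr => k _.
by rewrite pE scalerA exp_coeff_imaginary !mxE /re /im !rmorphM /= mulrDl -!mulrA.
Qed.

Lemma transition_eigen (R : realType) (n : nat) (M : 'M[R]_n) (v : 'cV[R]_n) (lam t : R) :
  M *m v = lam *: v ->
  transition_mx M t *m complexify v = cis (t * lam) *: complexify v.
Proof.
move=> Mv; apply: (@expmx_eigen (R[i] : numFieldType) _ _ _ ('i * (t * lam)%:C%C)).
- exact: is_cvg_series_transition.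
- exact: cvg_series_cis.
by rewrite -scalemxAl /complexify -map_mxM Mv map_mxZ scalerA rmorphM mulrA.
Qed.

(** * Laplacians as operators on functions of the vertices *)

Definition fun_vec (K : Type) (V : finType) (f : V -> K) : 'cV[K]_#|V| :=
  \col_i f (enum_val i).

(** The Laplacian as a difference operator: in this form degrees need not be
computed. *)
Definition lap (R : pzRingType) (V : finType) (G : sgraph V) (f : V -> R) (x : V) : R :=
  \sum_(y | G x y) (f x - f y).

Lemma laplacian_fun_vec (R : pzRingType) (V : finType) (G : sgraph V) (f : V -> R) :
  laplacian G R *m fun_vec f = fun_vec (lap G f).
Proof.
apply/colP => i; rewrite !mxE /lap sumrB sumr_const.
transitivity (\sum_j ((degree G (enum_val i))%:R *+ (i == j) * f (enum_val j)
    - (G (enum_val i) (enum_val j))%:R * f (enum_val j))).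
  by apply: eq_bigr => j _; rewrite !mxE mulrBl.
rewrite sumrB; congr (_ - _).
  rewrite (bigD1 i) //= eqxx mulr1n big1 ?addr0 => [|j]; last first.
    by rewrite eq_sym => /negPf ->; rewrite mul0r.
  by rewrite mulr_natl /degree; congr (_ *+ _); apply: eq_card => y; rewrite inE.
rewrite -(big_enum_val (A := V) (fun y => (G (enum_val i) y)%:R * f y)) /= [RHS]big_mkcond /=.
by apply: eq_bigr => y _; case: (G _ y); rewrite ?mul1r ?mul0r.
Qed.

Lemma vertex_vecE (R : pzRingType) (V : finType) (x : V) :
  vertex_vec R x = fun_vec (fun y => (y == x)%:R).
Proof.
apply/colP => i; rewrite !mxE eqxx andbT.
by rewrite -(can_eq (@enum_valK V)) enum_rankK.
Qed.

Definition on_prism (K : Type) (V : finType) (g h : V -> K) (p : (V + V)%type) : K :=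
  match p with inl x => g x | inr x => h x end.

Section Prism.
Variables (R : realType) (V : finType) (G : sgraph V).
Implicit Types g h : V -> R.

(** The Laplacians of a graph and of its complement add up to that of the complete
graph. *)
Lemma lap_complement g x :
  lap (complement G) g x = #|V|%:R * g x - \sum_y g y - lap G g x.
Proof.
rewrite -[LHS](addrK (lap G g x)); congr (_ - _).
rewrite mulr_natl -sumr_const -sumrB /lap.
rewrite [RHS](bigID (fun y => G x y)) /= addrC; congr (_ + _).
rewrite [RHS](bigID (pred1 x)) /= [X in _ = X + _]big1 ?add0r => [|y /andP[_ /eqP->]]; last by rewrite subrr.
by apply: eq_bigl => y; rewrite /= andbC eq_sym.
Qed.

Lemma lap_prism g h p :
  lap (complementary_prism G) (on_prism g h) p =
  on_prism (fun x => lap G g x + (g x - h x))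
           (fun x => lap (complement G) h x + (h x - g x)) p.
Proof.
rewrite /lap; case: p => x; rewrite big_sumType /=.
  by congr (_ + _); rewrite (big_pred1 x) // => y; rewrite eq_sym.
by rewrite addrC; congr (_ + _); rewrite (big_pred1 x) // => y; rewrite eq_sym.
Qed.

(** The vectors [(g, g)] and [(g, -g)] are eigenvectors of the prism, for [lam] and
[lam + 2]; [(g, 0)] is half their sum. *)
Lemma transition_prism_eigen g (lam t : R) :
  lap G g =1 (fun x => lam * g x) -> lap (complement G) g =1 (fun x => lam * g x) ->
  transition_mx (laplacian (complementary_prism G) R) t
    *m complexify (fun_vec (on_prism g (fun=> 0))) =
  cis (t * lam) *: fun_vec (on_prism
     (fun x => (1 + cis t ^+ 2) / 2 * (g x)%:C%C)
     (fun x => (1 - cis t ^+ 2) / 2 * (g x)%:C%C)).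
Proof.
move=> Gg Gcg; set L := laplacian _ _.
(* [1 - s] is the eigenvalue of a single edge on the vector [(1, s)]. *)
have ev s : s * s = 1 -> L *m fun_vec (on_prism g (fun x => s * g x)) =
    (lam + (1 - s)) *: fun_vec (on_prism g (fun x => s * g x)).
  move=> ss; rewrite laplacian_fun_vec; apply/colP => i; rewrite !mxE lap_prism.
  have lapZ x : lap (complement G) (fun x => s * g x) x = s * lap (complement G) g x.
    by rewrite /lap mulr_sumr; apply: eq_bigr => y _; rewrite mulrBr.
  case: (enum_val i) => x /=; rewrite ?lapZ ?Gg ?Gcg; first by ring.
  by ring: ss.
have -> : fun_vec (on_prism g (fun=> 0)) =
    2^-1 *: (fun_vec (on_prism g (fun x => 1 * g x)) +
             fun_vec (on_prism g (fun x => -1 * g x))).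
  by apply/colP => i; rewrite !mxE; case: (enum_val i) => x /=; field.
rewrite /complexify map_mxZ map_mxD -scalemxAr mulmxDr.
have e1 := transition_eigen t (ev 1 (mulr1 1)).
have e2 := transition_eigen t (ev (-1) (etrans (mulrNN 1 1) (mulr1 1))).
move: e1 e2; rewrite /complexify => -> ->.
rewrite subrr addr0 !opprK (mulrDr t lam (1 + 1)) cisD.
have -> : cis (t * (1 + 1)) = cis t ^+ 2 by rewrite -cisMn.
apply/colP => i; rewrite !mxE; case: (enum_val i) => x /=;
  by rewrite fmorphV rmorph_nat ?rmorphM ?rmorphN ?rmorph1; field.
Qed.
End Prism.

(** * Evolution on the complementary prism of a balanced complete bipartite graph *)

Section Bipartite.
Variables (R : realType) (V : finType) (G : sgraph V) (X Y : {set V}) (n : nat).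
Hypotheses (n0 : (0 < n)%N) (cX : #|X| = n) (cY : #|Y| = n).
Hypothesis GXY : complete_bipartite G X Y.

(** Every neighbour sum runs over a whole partite set, hence vanishes. *)
Lemma lap_bipartite (g : V -> R) :
  \sum_(y in X) g y = 0 -> \sum_(y in Y) g y = 0 ->
  lap G g =1 (fun x => n%:R * g x).
Proof.
move=> gX gY x; have [YE GE] := GXY.
have inY y : (y \in Y) = (y \notin X) by rewrite YE inE.
rewrite /lap sumrB sumr_const.
have [xX|xX] := boolP (x \in X).
  have GxY y : G x y = (y \in Y) by rewrite GE xX !inY xX /= orbF.
  by rewrite (eq_card GxY) cY (eq_bigl _ _ GxY) gY subr0 mulr_natl.
have GxX y : G x y = (y \in X) by rewrite GE !inY xX (negPf xX).
by rewrite (eq_card GxX) cX (eq_bigl _ _ GxX) gX subr0 mulr_natl.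
Qed.

Lemma sum_bipartition (g : V -> R) :
  \sum_y g y = \sum_(y in X) g y + \sum_(y in Y) g y.
Proof.
have [YE _] := GXY; rewrite (bigID (fun y => y \in X)) /=; congr (_ + _).
by apply: eq_bigl => y; rewrite YE inE.
Qed.

Lemma card_bipartition : #|V| = (n + n)%N.
Proof. by have [YE _] := GXY; rewrite -(cardsC X) -YE cX cY. Qed.

Lemma lap_complement_bipartite (g : V -> R) :
  \sum_(y in X) g y = 0 -> \sum_(y in Y) g y = 0 ->
  lap (complement G) g =1 (fun x => n%:R * g x).
Proof.
move=> gX gY x; rewrite lap_complement sum_bipartition gX gY (lap_bipartite gX gY).
by rewrite card_bipartition natrD; ring.
Qed.

Definition dev (a b x : V) : R := (x == a)%:R + (x == b)%:R - n%:R^-1.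

Variables (a b : V).
Hypotheses (aX : a \in X) (bY : b \in Y).

Lemma sum_dev : \sum_(y in X) dev a b y = 0 /\ \sum_(y in Y) dev a b y = 0.
Proof.
have nn : n%:R != 0 :> R by rewrite pnatr_eq0 -lt0n.
have [YE _] := GXY.
have abX : b \notin X by move: bY; rewrite YE inE.
have sum1 (Z : {set V}) c : \sum_(y in Z) (y == c)%:R = (c \in Z)%:R :> R.
  have [cZ|cZ] := boolP (c \in Z).
    by rewrite (bigD1 c) //= eqxx big1 ?addr0 // => y /andP[_ /negPf->].
  by rewrite big1 // => y yZ; case: eqP => // yc; rewrite yc (negPf cZ) in yZ.
have aY : a \notin Y by rewrite YE inE aX.
have sumc (Z : {set V}) : #|Z| = n -> \sum_(y in Z) n%:R^-1 = 1 :> R.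
  by move=> cZ; rewrite sumr_const cZ -[LHS]mulr_natr mulVf.
split; rewrite sumrB big_split /= !sum1 sumc //.
  by rewrite aX (negPf abX) addr0 subrr.
by rewrite bY (negPf aY) add0r subrr.
Qed.

Lemma transition_plus_state (t : R) :
  transition_mx (laplacian (complementary_prism G) R) t
    *m complexify (plus_state R (inl a) (inl b)) =
  (Num.sqrt 2)^-1%:C%C *: fun_vec (on_prism
     (fun x => (1 + cis t ^+ 2) / 2 * (n%:R^-1 + cis t ^+ n * (dev a b x)%:C%C))
     (fun x => (1 - cis t ^+ 2) / 2 * (n%:R^-1 + cis t ^+ n * (dev a b x)%:C%C))).
Proof.
have lap1 (H : sgraph V) : lap H (fun=> n%:R^-1 : R) =1 (fun=> 0 * n%:R^-1).
  by move=> x; rewrite mul0r /lap big1 // => y _; rewrite subrr.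
have [dX dY] := sum_dev.
have e1 := transition_prism_eigen t (lap1 G) (lap1 (complement G)).
have e2 := transition_prism_eigen t (lap_bipartite dX dY) (lap_complement_bipartite dX dY).
have -> : plus_state R (inl a) (inl b) = (Num.sqrt 2)^-1 *:
  (fun_vec (on_prism (fun=> n%:R^-1) (fun=> 0)) +
   fun_vec (on_prism (dev a b) (fun=> 0))).
  rewrite /plus_state !vertex_vecE; congr (_ *: _); apply/colP => i; rewrite !mxE.
  by case: (enum_val i) => x; rewrite /= ?addr0 // /dev [RHS]addrC subrK.
rewrite /complexify map_mxZ map_mxD -scalemxAr mulmxDr.
move: e1 e2; rewrite /complexify => -> ->.
rewrite mulr0 cis0 scale1r cisMn; congr (_ *: _).
apply/colP => i; rewrite !mxE; case: (enum_val i) => x /=;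
  rewrite fmorphV rmorph_nat; ring.
Qed.

(** At time pi / 2 the square of exp(it) is -1, so nothing is left on G. *)
Lemma transition_plus_state_pihalf :
  transition_mx (laplacian (complementary_prism G) R) (pi / 2)
    *m complexify (plus_state R (inl a) (inl b)) =
  (Num.sqrt 2)^-1%:C%C *: fun_vec (on_prism
     (fun=> 0) (fun x => n%:R^-1 + 'i ^+ n * (dev a b x)%:C%C)).
Proof.
rewrite transition_plus_state cis_pihalf sqrCi; congr (_ *: _).
apply/colP => i; rewrite !mxE.
have -> : (1 - -1) / 2 = 1 :> R[i] by field.
by case: (enum_val i) => x /=; rewrite ?mul1r // subrr !mul0r.
Qed.
End Bipartite.

Lemma plus_stateE (R : realType) (V : finType) (x y : V) :
  plus_state R x y =
  fun_vec (fun z => (Num.sqrt 2)^-1 * ((z == x)%:R + (z == y)%:R)).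
Proof. by rewrite /plus_state !vertex_vecE; apply/colP => i; rewrite !mxE. Qed.

Lemma complexify_plus_state_inr (R : realType) (V : finType) (c d : V) :
  complexify (plus_state R (inr c) (inr d)) = (Num.sqrt 2)^-1%:C%C *:
    fun_vec (on_prism (fun=> 0) (fun x => ((x == c)%:R + (x == d)%:R)%:C%C)).
Proof.
rewrite plus_stateE; apply/colP => i; rewrite !mxE rmorphM /=.
by case: (enum_val i) => x /=; rewrite ?addr0.
Qed.

(** * Perfect state transfer *)

Lemma pst_plus_state (R : realType) (V : finType) (M : 'M[R]_#|V|) (a b c d : V) :
  a != b -> c != d -> a != c -> a != d ->
  perfect_state_transfer M (plus_state R a b) (plus_state R c d) <->
  exists (tau : R) (gamma : R[i]),
    [/\ 0 < tau, `|gamma| = 1 &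
      transition_mx M tau *m complexify (plus_state R a b) =
      gamma *: complexify (plus_state R c d)].
Proof.
move=> ab cd ac ad; split=> [[]//|ex].
have s2 : Num.sqrt 2 ^+ 2 = 2 :> R by rewrite sqr_sqrtr.
have s0 : Num.sqrt 2 != 0 :> R by rewrite sqrtr_eq0 -ltNge.
have unit (x y : V) : x != y -> unit_vec (plus_state R x y).
  move=> xy; rewrite /unit_vec plus_stateE.
  under eq_bigr do rewrite mxE.
  rewrite -(big_enum_val (A := V) (fun z : V => ((Num.sqrt 2)^-1 * ((z == x)%:R + (z == y)%:R)) ^+ 2)) /=.
  rewrite (bigD1 x) // (bigD1 y) 1?eq_sym //= big1 ?addr0 => [|z /andP[/negPf-> /negPf->]]; last first.
    by rewrite addr0 mulr0 expr0n.
  rewrite !eqxx [y == x]eq_sym (negPf xy) addr0 add0r mulr1 exprVn s2.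
  by rewrite -[RHS](@sqrtr1 R); congr Num.sqrt; field.
split=> //; [exact: unit|exact: unit|].
rewrite free_cons seq1_free; apply/andP; split; last first.
  apply/eqP => /colP/(_ (enum_rank c)); rewrite plus_stateE !mxE enum_rankK eqxx (negPf cd).
  by rewrite addr0 mulr1 => /eqP; rewrite invr_eq0 (negPf s0).
rewrite span_seq1; apply/vlineP => -[k /colP/(_ (enum_rank a))].
rewrite !plus_stateE !mxE enum_rankK eqxx (negPf ab) (negPf ac) (negPf ad).
by rewrite !addr0 !mulr0 mulr1 => /eqP; rewrite invr_eq0 (negPf s0).
Qed.

(** Such a [z] is a primitive fourth root of unity. *)
Lemma expr_eq1_dvd4 (K : numFieldType) (z : K) (n : nat) :
  z ^+ 2 = -1 -> (z ^+ n == 1) = (4 %| n)%N.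
Proof.
move=> z2; have z4 : z ^+ 4 = 1 by rewrite (exprM z 2 2) z2 sqrrN expr1n.
rewrite {1}(divn_eq n 4) exprD mulnC exprM z4 expr1n mul1r /dvdn.
have n1 : (-1 == 1 :> K) = false by apply/negP; rewrite -subr_eq0 -opprD oppr_eq0 -[1 + 1]/(2%:R) pnatr_eq0.
have z1 : (z == 1) = false by apply/negP => /eqP e; move: z2 n1; rewrite e expr1n => <-; rewrite eqxx.
have zN : (-z == 1) = false.
  by apply/negP => /eqP e; move: z2 n1; rewrite -sqrrN e expr1n => <-; rewrite eqxx.
have : (n %% 4 < 4)%N by rewrite ltn_mod.
move: (n %% 4)%N => [|[|[|[|]]]] //= _.
- by rewrite expr0 eqxx.
- by rewrite z2 n1.
- by rewrite exprS z2 mulrN1 zN.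
Qed.

(** For a vertex [x] of [X] other than [a], the amplitudes at [x], [x'] and [a] must
vanish.  The first two add up to [1/n - z^n/n], so [z^n = 1]; the third then gives
[z^2 = -1]. *)
Lemma transfer_dvd4 (R : realType) (n : nat) (V : finType) (G : sgraph V)
    (X Y : {set V}) (a b : V) (t : R) (gam : R[i]) :
  (1 < n)%N -> #|X| = n -> #|Y| = n -> complete_bipartite G X Y ->
  a \in X -> b \in Y ->
  transition_mx (laplacian (complementary_prism G) R) t
    *m complexify (plus_state R (inl a) (inl b)) =
  gam *: complexify (plus_state R (inr a) (inr b)) ->
  (4 %| n)%N.
Proof.
move=> n2 cX cY GXY aX bY.
have n0 : (0 < n)%N by apply: leq_trans n2.
have nn : n%:R != 0 :> R[i] by rewrite pnatr_eq0 -lt0n.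
have s0 : (Num.sqrt 2)^-1%:C%C != 0 :> R[i].
  by rewrite fmorph_eq0 invr_eq0 sqrtr_eq0 -ltNge.
have ab : a != b.
  by apply: contraTneq bY => <-; have [-> _] := GXY; rewrite inE aX.
rewrite (transition_plus_state n0 cX cY GXY aX bY) complexify_plus_state_inr.
rewrite scalerA [gam * _]mulrC -scalerA.
move=> E0; have E := scalerI s0 E0.
(* [x'] carries no target amplitude, so that [gam] drops out. *)
have [x xX xa] : exists2 x, x \in X & x != a.
  have : (0 < #|X :\ a|)%N by move: n2; rewrite -cX (cardsD1 a) aX; case: #|_|.
  by case/card_gt0P => x; rewrite !inE => /andP[]; exists x.
have xb : x != b.
  by apply: contraTneq bY => <-; have [-> _] := GXY; rewrite inE xX.
have El y := congr1 (fun v : 'cV_ _ => v (enum_rank (inl y : V + V)%type) 0) E.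
have Er := congr1 (fun v : 'cV_ _ => v (enum_rank (inr x : V + V)%type) 0) E.
move: (El x) (El a) Er; rewrite !mxE !enum_rankK /= /dev.
rewrite eqxx (negPf ab) (negPf xa) (negPf xb) !(addr0, add0r, mulr0).
rewrite !(rmorphN, rmorphB, rmorph1, rmorph0, fmorphV, rmorph_nat) /=.
set z := cis t => e1 e2 e3.
have zn : z ^+ n = 1.
  have : n%:R^-1 - z ^+ n * n%:R^-1 = 0.
    by apply: (etrans _ (etrans (congr2 +%R e1 e3) (addr0 0))); field.
  by move/eqP; rewrite subr_eq0 -[X in X == _]mul1r (inj_eq (mulIf (invr_neq0 nn))) => /eqP.
have z2 : z ^+ 2 = -1.
  apply/eqP; rewrite -addr_eq0 addrC; apply/eqP.
  rewrite -[RHS](mulr0 2) -e2 zn; field; exact: nn.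
by rewrite -(expr_eq1_dvd4 n z2) zn.
Qed.

Theorem theorem15 (R : realType) :
  (forall (n : nat) (V : finType) (G : sgraph V) (X Y : {set V}) (a b : V),
     (2 < n)%N -> #|X| = n -> #|Y| = n -> complete_bipartite G X Y ->
     a \in X -> b \in Y ->
     perfect_state_transfer (laplacian (complementary_prism G) R)
       (plus_state R (inl a) (inl b)) (plus_state R (inr a) (inr b))
     <-> (4 %| n)%N)
  /\
  (forall (V : finType) (G : sgraph V) (v1 v2 v3 v4 : V),
     v1 != v2 -> v3 != v4 ->
     complete_bipartite G [set v1; v2]%SET [set v3; v4]%SET ->
     perfect_state_transfer (laplacian (complementary_prism G) R)
       (plus_state R (inl v1) (inl v3)) (plus_state R (inr v2) (inr v4))).
Proof.
split=> [n V G X Y a b n2 cX cY GXY aX bY|V G v1 v2 v3 v4 v12 v34 GXY].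
  have n0 : (0 < n)%N by apply: leq_trans n2.
  have nn : n%:R != 0 :> R[i] by rewrite pnatr_eq0 -lt0n.
  have ab : a != b.
    by apply: contraTneq bY => <-; have [-> _] := GXY; rewrite inE aX.
  rewrite pst_plus_state //; split=> [[t [gam [_ _ E]]]|n4].
    exact: (transfer_dvd4 (ltnW n2) cX cY GXY aX bY E).
  exists (pi / 2), 1; split; first by rewrite divr_gt0 ?pi_gt0.
    by rewrite normr1.
  rewrite (transition_plus_state_pihalf R n0 cX cY GXY aX bY).
  rewrite complexify_plus_state_inr scale1r.
  rewrite (eqP (etrans (expr_eq1_dvd4 n (sqrCi _)) n4)).
  congr (_ *: _); apply/colP => i; rewrite !mxE.
  case: (enum_val i) => x //=.
  by rewrite /dev rmorphB fmorphV rmorph_nat; field.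
have cX : #|[set v1; v2]%SET| = 2 by rewrite cards2 v12.
have cY : #|[set v3; v4]%SET| = 2 by rewrite cards2 v34.
have v1X : v1 \in [set v1; v2]%SET by rewrite !inE eqxx.
have v3Y : v3 \in [set v3; v4]%SET by rewrite !inE eqxx.
have [YE _] := GXY.
have XY x : (x == v3) || (x == v4) = ~~ ((x == v1) || (x == v2)).
  by have := congr1 (fun A : {set V} => x \in A) YE; rewrite !inE.
have v13 : v1 != v3 by move: v3Y; rewrite YE !inE negb_or eq_sym => /andP[].
have v24 : v2 != v4 by have := XY v4; rewrite eqxx orbT => /esym; rewrite negb_or eq_sym => /andP[_]; rewrite eq_sym.
rewrite pst_plus_state //; exists (pi / 2), 1; split; first by rewrite divr_gt0 ?pi_gt0.
  by rewrite normr1.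
rewrite (transition_plus_state_pihalf R _ cX cY GXY v1X v3Y) //.
rewrite complexify_plus_state_inr scale1r sqrCi.
congr (_ *: _); apply/colP => i; rewrite !mxE.
case: (enum_val i) => x //=.
(* The parts exhaust the graph, so the indicator of {v2, v4} is 1 minus that of
   {v1, v3}, which is what the factor i^2 = -1 on the deviation produces. *)
have one : (x == v1)%:R + (x == v2)%:R + (x == v3)%:R + (x == v4)%:R = 1 :> R[i].
  have := XY x; have [->|] := eqVneq x v1.
    rewrite (negPf v12) (negPf v13) /=; case: eqP => //= _ _; by rewrite !addr0.
  have [->|] := eqVneq x v2.
    by rewrite (negPf v24) orbF => _; case: eqP => //= _ _; rewrite add0r !addr0.
  move=> _ _ /=; have [->|] := eqVneq x v3; first by rewrite (negPf v34) => _; rewrite !add0r addr0.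
  by move=> _ /= ->; rewrite !add0r.
rewrite /dev !(rmorphB, rmorphD) fmorphV !rmorph_nat /=.
have -> : (x == v2)%:R + (x == v4)%:R = 1 - (x == v1)%:R - (x == v3)%:R :> R[i].
  by rewrite -[X in X - _ - _]one; ring.
by field.
Qed.
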